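(* Let $b\ge 2$ and $m\ge 1$ be integers, let $\Sigma$ be an alphabet with $m$ letters, let $\sigma:\Sigma\to\Sigma$ be a cyclic permutation of $\Sigma$ (a single $m$-cycle), let $\overline{\alpha}\in\Sigma$, and let $\mathbf{t}$ be the generalized Thue–Morse word defined by $b,m,\sigma,\overline{\alpha}$. Then the critical exponent of $\mathbf{t}$ is \[ E(\mathbf{t})=\begin{cases}\infty & \text{if } m\mid (b-1),\\ 2b/m & \text{if } m\nmid (b-1) \text{ and } b>m,\\ 2 & \text{if } b\le m.\end{cases}\]
   Context: Let $\mu:\Sigma^*\to\Sigma^*$ be the morphism defined on letters by $\mu(\alpha)=\sigma^0(\alpha)\sigma^1(\alpha)\sigma^2(\alpha)\cdots\sigma^{b-1}(\alpha)$. The generalized Thue–Morse word is the infinite word $\mathbf{t}=\lim_{n\to\infty}\mu^n(\overline{\alpha})=\mathbf{t}[0]\mathbf{t}[1]\mathbf{t}[2]\cdots$; equivalently $\mathbf{t}[n]=\sigma^{s_b(n)}(\overline{\alpha})$, where $s_b(n)$ is the sum of the digits of $n$ in base $b$. For a nonempty finite word $w$ and a rational $r>0$ with $r|w|\in\mathbb N$, the rational power is $w^r=w^{\lfloor r\rfloor}p$ where $p$ is the prefix of $w$ of length $(r-\lfloor r\rfloor)|w|$. For a factor $w$ of an infinite word $\mathbf{x}$, $\textsc{Index}(w)=\max\{r\in\mathbb Q: w^r \text{ is a factor of } \mathbf{x}\}$ if this maximum exists, and $\infty$ otherwise. The critical exponent is $E(\mathbf{x})=\sup\{\textsc{Index}(w):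 w \text{ a nonempty factor of } \mathbf{x}\}$. *)

(* Defs.v *)
From mathcomp Require Import all_boot all_order all_algebra all_fingroup.
From mathcomp Require Import all_classical all_reals all_analysis.

Set Implicit Arguments.
Unset Strict Implicit.
Unset Printing Implicit Defensive.

Import Order.TTheory GRing.Theory Num.Theory.

Local Open Scope classical_set_scope.
Local Open Scope ring_scope.

(** A finite word over [T] is a [seq T]; an infinite word is a function
    [nat -> T]. *)

Section GeneralizedThueMorse.
Context {T : finType}.

(** [porbits] includes the singleton orbits of fixed points, so a single orbit
    means a single cycle running through all of [T] (when [T] has one letter,
    this is the identity). *)
Definition cyclic_permutation (sigma : {perm T}) : Prop :=
  #|porbits sigma| = 1%N.

Definition mu_letter (b : nat) (sigma : {perm T}) (a : T) : seq T :=
  mkseq (fun i => iter i sigma a) b.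

Definition mu (b : nat) (sigma : {perm T}) (w : seq T) : seq T :=
  flatten (map (mu_letter b sigma) w).

(** The limit of the words [mu^n(a)]: for [2 <= b] each is a prefix of the next
    and [mu^n(a)] has length [b ^ n > n], so position [n] is already settled in
    [mu^n(a)], and the default value of [nth] is never used; see
    [gen_thue_morse_limit]. *)
Definition gen_thue_morse (b : nat) (sigma : {perm T}) (a : T) : nat -> T :=
  fun n => nth a (iter n (mu b sigma) [:: a]) n.

Definition word_limit (u : nat -> seq T) (x : nat -> T) : Prop :=
  forall k, exists N, forall n, (N <= n)%N -> prefix (mkseq x k) (u n).

Lemma mu_cat b sigma (v w : seq T) :
  mu b sigma (v ++ w) = mu b sigma v ++ mu b sigma w.
Proof. by rewrite /mu map_cat flatten_cat. Qed.

Lemma size_mu b sigma (w : seq T) : size (mu b sigma w) = (b * size w)%N.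
Proof.
elim: w => [|a w IHw]; first by rewrite muln0.
by rewrite /mu /= size_cat size_mkseq -/(mu b sigma w) IHw mulnS.
Qed.

Lemma size_iter_mu b sigma (a : T) n :
  size (iter n (mu b sigma) [:: a]) = (b ^ n)%N.
Proof. by elim: n => // n IHn; rewrite iterS size_mu IHn expnS. Qed.

Lemma prefix_iter_mu b sigma (a : T) m n : (1 <= b)%N -> (m <= n)%N ->
  prefix (iter m (mu b sigma) [:: a]) (iter n (mu b sigma) [:: a]).
Proof.
move=> b_gt0 /subnK <-.
elim: (n - m)%N => [|k IHk]; first exact: prefix_refl.
apply: prefix_trans IHk _; rewrite addSn.
elim: (k + m)%N => [|j /prefixP[w IHj]].
  by case: b b_gt0 => // b _; rewrite /mu /= eqxx; exact: prefix0s.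
rewrite [X in prefix _ X]iterS {2}IHj mu_cat -iterS.
exact: prefix_prefix.
Qed.

Lemma gen_thue_morse_limit b sigma (a : T) : (2 <= b)%N ->
  word_limit (fun n => iter n (mu b sigma) [:: a]) (gen_thue_morse b sigma a).
Proof.
move=> b_gt1 k; exists k => n le_kn; have b_gt0 := ltnW b_gt1.
have szn : (k <= size (iter n (mu b sigma) [:: a]))%N.
  by rewrite size_iter_mu (leq_trans le_kn)// ltnW// ltn_expl.
rewrite prefixE size_mkseq; apply/eqP/(@eq_from_nth _ a).
  by rewrite size_takel// size_mkseq.
move=> i; rewrite size_takel// => lt_ik.
rewrite nth_take// nth_mkseq// /gen_thue_morse.
have /prefixP[w ->] :=
  prefix_iter_mu sigma a b_gt0 (ltnW (leq_trans lt_ik le_kn)).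
by rewrite nth_cat size_iter_mu ltn_expl.
Qed.

End GeneralizedThueMorse.

Section CriticalExponent.
Context {T : choiceType}.

Definition is_factor (x : nat -> T) (w : seq T) : Prop :=
  exists i, w = mkseq (fun j => x (i + j)%N) (size w).

(** [Num.truncn] is the floor on nonnegative numbers.  Only meant for [0 < r]
    with [r * (size w)%:R] a natural number, which [exponents] requires. *)
Definition rat_power (w : seq T) (r : rat) : seq T :=
  flatten (nseq (Num.truncn r) w) ++
  take (Num.truncn ((r - (Num.truncn r)%:R) * (size w)%:R)) w.

Definition exponents (x : nat -> T) (w : seq T) : set rat :=
  [set r : rat | [/\ 0 < r, r * (size w)%:R \is a Num.nat
                   & is_factor x (rat_power w r)]].

(** [A `&` ubound A] is the set of maxima of [A] (at most one element);
    [xget] returns its default value [+oo] when there is none. *)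
Definition Index (R : realType) (x : nat -> T) (w : seq T) : \bar R :=
  let A := exponents x w in
  xget +oo%E [set (ratr r)%:E | r in A `&` ubound A].

Definition critical_exponent (R : realType) (x : nat -> T) : \bar R :=
  ereal_sup [set Index R x w | w in [set w | w <> [::] /\ is_factor x w]].

End CriticalExponent.

(* Main.v *)
Require Import Defs.
From mathcomp Require Import all_boot all_order all_algebra all_fingroup.
From mathcomp Require Import all_classical all_reals all_analysis.
From mathcomp Require Import zify.

Set Implicit Arguments.
Unset Strict Implicit.
Unset Printing Implicit Defensive.

Import Order.TTheory GRing.Theory Num.Theory.

Local Open Scope ring_scope.

(** The letters satisfy [t(b q + r) = sigma^r (t q)] for [r < b].  Suppose that a
    factor of length [N] has period [p].  If [b] divides [p], passing to the
    quotients by [b] of its positions gives a factor of period [p / b] whose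
    exponent is at least as large, so let [b] not divide [p].  If [N > 2 p],
    each multiple [n] of [b] inside the factor is at distance [p] from a
    non-multiple of [b] inside it, where [t] makes a step [sigma]; as [m] does
    not divide [b - 1], this forces [b ^ 2] to divide [n].  Hence at most one
    multiple of [b] lies inside, so [N <= 2 b], and comparing two letters at
    distance [p] in one block gives [m %| p].  Thus every exponent is at most
    [2] or at most [2 b / m].  The bound [2 b / m] is attained around position
    [b ^ m], the bound [2] by the square of period [b - 1] starting at
    position [1].  If [m] divides [b - 1], then [t] has period [m]. *)

(** * Orbits of a cyclic permutation and the block recursion *)

Lemma iter_fix_dvdn (T : Type) (f : T -> T) (y : T) m k :
  iter m f y = y -> (m %| k)%N -> iter k f y = y.
Proof. by move=> fy /dvdnP[c ->]; rewrite iterM iter_fix. Qed.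

(** The orbit of [y] is all of [T], so its first [#|T|] iterates are pairwise distinct. *)
Lemma iter_cyclic_eq (T : finType) (s : {perm T}) (y : T) k :
  cyclic_permutation s -> (iter k s y == y) = (#|T| %| k)%N.
Proof.
rewrite /cyclic_permutation => /eqP/cards1P[A porbitsA].
have pA z : porbit s z = A.
  by apply/set1P; rewrite -porbitsA; apply: imset_f.
have cardT : #|porbit s y| = #|T|.
  by apply: eq_card => z; rewrite pA -(pA z) porbit_id.
have iterT := iter_porbit s y; rewrite cardT in iterT.
have T_gt0 : (0 < #|T|)%N by apply/card_gt0P; exists y.
apply/eqP/idP => [|/(iter_fix_dvdn iterT)//].
rewrite {1}(divn_eq k #|T|) addnC iterD (iter_fix_dvdn iterT) ?dvdn_mull//.
have := uniq_traject_porbit s y; rewrite cardT => uniqT.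
have ltr := ltn_pmod k T_gt0; move=> iter_r; rewrite /dvdn.
rewrite -(nth_uniq y _ _ uniqT) ?size_traject//.
by rewrite !nth_traject//= iter_r.
Qed.

Lemma gen_thue_morse_iter (T : finType) b (s : {perm T}) a k n :
  (2 <= b)%N -> (n < b ^ k)%N ->
  gen_thue_morse b s a n = nth a (iter k (mu b s) [:: a]) n.
Proof.
move=> b_gt1 lt_n; have b_gt0 := ltnW b_gt1; rewrite /gen_thue_morse.
have [le_kn|lt_nk] := leqP k n.
  have /prefixP[w ->] := prefix_iter_mu s a b_gt0 le_kn.
  by rewrite nth_cat size_iter_mu lt_n.
have /prefixP[w ->] := prefix_iter_mu s a b_gt0 (ltnW lt_nk).
by rewrite nth_cat size_iter_mu ltn_expl.
Qed.

Lemma nth_mu (T : finType) b (s : {perm T}) a w q r :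
  (q < size w)%N -> (r < b)%N ->
  nth a (mu b s w) (b * q + r) = iter r s (nth a w q).
Proof.
elim: w q => // c w IHw [|q] /= lt_q lt_r.
  by rewrite /mu /= nth_cat size_mkseq muln0 add0n lt_r nth_mkseq.
rewrite /mu /= nth_cat size_mkseq -/(mu b s w) mulnS -addnA ltnNge leq_addr /=.
by rewrite addKn IHw.
Qed.

Lemma gen_thue_morse_block (T : finType) b (s : {perm T}) a q r :
  (2 <= b)%N -> (r < b)%N ->
  gen_thue_morse b s a (b * q + r) = iter r s (gen_thue_morse b s a q).
Proof.
move=> b_gt1 lt_r; have lt_q : (q < b ^ q)%N by rewrite ltn_expl.
rewrite (@gen_thue_morse_iter _ _ _ _ q.+1)// ?iterS ?nth_mu ?size_iter_mu//.
by rewrite expnS; nia.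
Qed.

(* That is, [x n] is [s^(s_b(n)) (x 0)], where [s_b] is the base-[b] digit sum. *)
Definition digit_sum_word (T : finType) b (s : {perm T}) (x : nat -> T) : Prop :=
  forall q r, (r < b)%N -> x (b * q + r)%N = iter r s (x q).

(** * Lengths of runs with a given period *)

Section DigitSumWord.
Context {T : finType} {b : nat} {s : {perm T}} {x : nat -> T}.
Hypotheses (b_gt1 : (2 <= b)%N) (s_cyclic : cyclic_permutation s).
Hypothesis x_block : digit_sum_word b s x.

Lemma digit_sum_word_add j p :
  (j %/ b = (j + p) %/ b)%N -> x (j + p)%N = iter p s (x j).
Proof.
move=> eq_div; have b_gt0 := ltnW b_gt1.
have [lt1 lt2] := (ltn_pmod j b_gt0, ltn_pmod (j + p) b_gt0).
have := divn_eq j b; have := divn_eq (j + p) b; rewrite -eq_div.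
move: (j %/ b)%N (j %% b)%N ((j + p) %% b)%N lt1 lt2 => q r r' lt1 lt2 eq2 eq1.
by rewrite eq2 eq1 ![(q * b)%N]mulnC !x_block// -iterD; congr iter; lia.
Qed.

(* At a multiple of [b] that is not a multiple of [b ^ 2] the digit sum drops
   by [b - 2], which is a step of [1] modulo [#|T|] only if [#|T|] divides
   [b - 1]. *)
Lemma digit_sum_word_drop q :
  ~~ (#|T| %| b - 1)%N -> (0 < q)%N -> x (b * q)%N = s (x (b * q).-1)%N ->
  (b %| q)%N.
Proof.
move=> mNb; case: q => // q _ xE; apply/negPn/negP => bNq.
have eq_div : (q %/ b = q.+1 %/ b)%N by rewrite divnS ?(ltnW b_gt1)//; lia.
have xS : x q.+1 = s (x q) by rewrite -addn1 digit_sum_word_add ?addn1.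
move: xE; have -> : ((b * q.+1).-1 = b * q + b.-1)%N by nia.
rewrite -[X in x X = _]addn0 !x_block; [|lia..].
rewrite /= xS => /perm_inj /esym/eqP.
by rewrite iter_cyclic_eq// -subn1 (negPf mNb).
Qed.

(** A factor of length [L + p] with period [p] amounts to [L] comparisons of letters, so [p < L]
    says that its exponent exceeds 2. *)
Lemma short_run_nondvdn i p L : ~~ (#|T| %| b - 1)%N -> ~~ (b %| p)%N ->
  (p < L)%N -> (forall j, (i <= j < i + L)%N -> x j = x (j + p)%N) ->
  (#|T| <= p)%N /\ (L + p <= 2 * b)%N.
Proof.
move=> mNb bNp ltpL run; have b_gt0 := ltnW b_gt1.
have p_gt0 : (0 < p)%N by rewrite lt0n; apply: contra bNp => /eqP->.
have step n : (0 < n)%N -> ~~ (b %| n)%N -> x n = s (x n.-1).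
  case: n => // n _ bNn; rewrite -addn1 digit_sum_word_add ?addn1//.
  by rewrite divnS//; lia.
have mulb q : (i < b * q < i + L + p)%N -> (b %| q)%N.
  move=> lt_q; apply: digit_sum_word_drop => //; first by case: q lt_q => //; lia.
  (* First case: shift forward by [p]. In the other case the shift is backward, and [p < L] keeps it
     inside the factor. *)
  have [lt_qL|le_Lq] := ltnP (b * q) (i + L).
    rewrite (run (b * q)%N) ?(run (b * q).-1); [|lia..].
    rewrite step; [congr (s (x _)); lia|lia|].
    by rewrite dvdn_addr ?dvdn_mulr.
  have -> : (b * q = (b * q - p) + p)%N by lia.
  have -> : (((b * q - p) + p).-1 = (b * q - p).-1 + p)%N by lia.
  rewrite -(run (b * q - p)%N) -?(run (b * q - p).-1); [|lia..].
  by apply: step; [lia|rewrite dvdn_subr ?dvdn_mulr//; lia].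
have div_i := divn_eq i b; have lt_mod := ltn_pmod i b_gt0.
set q := (i %/ b)%N in div_i.
(* Otherwise [b] would divide both [q.+1] and [q.+2]. *)
have noboth : (b * q.+2 < i + L + p)%N -> False.
  move=> ltq; have /mulb d1 : (i < b * q.+1 < i + L + p)%N by nia.
  have /mulb : (i < b * q.+2 < i + L + p)%N by nia.
  by rewrite -addn1 dvdn_addr// dvdn1; lia.
split; last by rewrite leqNgt; apply/negP => ltb; apply: noboth; nia.
have le_end : (i + L + p <= b * q.+2)%N by rewrite leqNgt; apply/negP.
(* Either [i] and [i + p] share block [q], or [i + p] and [i + 2p] share block [q.+1]. *)
have [j [Hj Hdiv]] : exists j, (i <= j < i + L)%N /\ (j %/ b = (j + p) %/ b)%N.
  have [lt_ip|le_ip] := ltnP (i + p) (b * q.+1).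
    exists i; split; [lia|]; symmetry.
    by apply/eqP; rewrite eqn_leq andbC leq_div2r ?leq_addr//= -ltnS ltn_divLR//; nia.
  exists (i + p)%N; split; [lia|].
  have divE n : (b * q.+1 <= n < b * q.+2)%N -> (n %/ b = q.+1)%N.
    move=> /andP[le_n lt_n]; apply/eqP; rewrite eqn_leq -ltnS.
    by rewrite ltn_divLR// leq_divRL// mulnC lt_n mulnC.
  by rewrite !divE//; lia.
apply: dvdn_leq => //; rewrite -(iter_cyclic_eq (x j) p s_cyclic).
by rewrite -digit_sum_word_add// -run.
Qed.

(* Dividing by [b] a run whose period is a multiple of [b] does not decrease
   the ratio of its length to its period. *)
Lemma short_run i p L : ~~ (#|T| %| b - 1)%N -> (0 < p)%N ->
  (forall j, (i <= j < i + L)%N -> x j = x (j + p)%N) ->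
  (L <= p)%N \/ (#|T| * (L + p) <= 2 * b * p)%N.
Proof.
move=> mNb; have b_gt0 := ltnW b_gt1.
elim/ltn_ind: p i L => p IHp i L p_gt0 run.
have [leLp|ltpL] := leqP L p; first by left.
have [/dvdnP[p' def_p]|bNp] := boolP (b %| p)%N; last first.
  have [le_mp leb] := short_run_nondvdn mNb bNp ltpL run.
  by right; rewrite mulnC leq_mul.
have p'_gt0 : (0 < p')%N by lia.
have lt_p' : (p' < p)%N by rewrite def_p; nia.
have divn_bounds n : (b * (n %/ b) <= n < b * (n %/ b) + b)%N.
  by rewrite mulnC leq_trunc_div -mulSnr ltn_ceil.
have := leq_div2r b (leq_addr L.-1 i).
move: (i %/ b)%N (divn_bounds i) ((i + L.-1) %/ b)%N (divn_bounds (i + L.-1)).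
move=> u u_i v v_iL le_uv.
have le_L : (L <= b * (v - u).+1)%N by rewrite mulnS mulnBr; lia.
have run' j : (u <= j < u + (v - u).+1)%N -> x j = x (j + p')%N.
  (* A position of block [j] inside the run; as [b] divides [p], adding [p] keeps its last digit
     [r], and [iter r s] cancels by injectivity. *)
  move=> Hj; pose k := maxn i (b * j).
  have le_bj : (b * u <= b * j <= b * v)%N by rewrite !leq_mul2l; lia.
  have [r lt_r def_k] : exists2 r, (r < b)%N & k = (b * j + r)%N.
    by exists (k - b * j)%N; rewrite /k; lia.
  have /run : (i <= k < i + L)%N by rewrite /k; lia.
  have -> : (k + p = b * (j + p') + r)%N by rewrite def_k def_p mulnDr; lia.
  rewrite def_k !x_block//.
  by elim: r {lt_r def_k} => //= r IHr /perm_inj.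
have [le_L'|le_m] := IHp p' lt_p' _ _ p'_gt0 run'.
  by move: ltpL; rewrite def_p ltnNge mulnC (leq_trans le_L)// leq_mul2l le_L' orbT.
right; rewrite def_p [X in (_ <= X)%N]mulnA -[X in (_ <= X)%N]mulnC.
apply: leq_trans (leq_mul (leqnn b) le_m).
by rewrite mulnCA leq_mul2l mulnDr [(p' * b)%N]mulnC leq_add2r le_L orbT.
Qed.

(** * Explicit letters and the extremal runs *)

Lemma digit_sum_word_small j : (j < b)%N -> x j = iter j s (x 0%N).
Proof. by move=> lt_j; rewrite -x_block// muln0. Qed.

(** All [k] digits of [b ^ k - 1] equal [b - 1]. *)
Lemma digit_sum_word_last k :
  x (b ^ k).-1 = iter (k * b.-1) s (x 0%N).
Proof.
elim: k => [//|k IHk].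
have -> : ((b ^ k.+1).-1 = b * (b ^ k).-1 + b.-1)%N.
  by rewrite expnS; have := expn_gt0 b k; nia.
by rewrite x_block ?IHk -?iterD ?mulSn//; lia.
Qed.

Lemma digit_sum_word_pow k : x (b ^ k)%N = s (x 0%N).
Proof.
elim: k => [|k IHk]; first exact: digit_sum_word_small.
by rewrite expnS -[X in x X]addn0 x_block ?(ltnW b_gt1).
Qed.

(** A number is congruent to its digit sum modulo [b - 1], hence modulo [#|T|]. *)
Lemma digit_sum_word_periodic n : (#|T| %| b - 1)%N ->
  x n = iter n s (x 0%N).
Proof.
move=> mb; have b_gt0 := ltnW b_gt1.
elim/ltn_ind: n => n IHn; have [->//|n_gt0] := posnP n.
have := divn_eq n b; set q := (n %/ b)%N; set r := (n %% b)%N => def_n.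
have lt_r : (r < b)%N by rewrite ltn_pmod.
have lt_q : (q < n)%N by rewrite ltn_Pdiv.
rewrite {1}def_n mulnC x_block// IHn// -iterD.
have -> : (n = (r + q) + q * (b - 1))%N by nia.
rewrite [RHS]iterD (_ : iter (q * _) s _ = x 0%N)//.
by apply/eqP; rewrite iter_cyclic_eq// dvdn_mull.
Qed.

(* The letters at [b ^ (m - 1) - 1] and [b ^ (m - 1)] are [c] and [s^b c], so
   their images concatenate to a run of [2 b] consecutive powers of [s]. *)
Lemma long_run j : (j < 2 * b)%N ->
  x (b * (b ^ #|T|.-1).-1 + j)%N = iter j s (x (b ^ #|T|.-1).-1)%N.
Proof.
move=> lt_j; have b_gt0 := ltnW b_gt1.
have [lt_jb|le_bj] := ltnP j b; first exact: x_block.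
set n := (b ^ #|T|.-1)%N.
have n_gt0 : (0 < n)%N by rewrite expn_gt0 b_gt0.
have T_gt0 : (0 < #|T|)%N by apply/card_gt0P; exists (x 0%N).
have -> : (b * n.-1 + j = b * n + (j - b))%N by nia.
rewrite x_block; last by lia.
rewrite digit_sum_word_pow digit_sum_word_last -iterSr -iterD.
(* The exponent [#|T|.-1] makes the two powers of [s] differ by a multiple of [#|T|]. *)
have -> : (j + #|T|.-1 * b.-1 = (j - b).+1 + #|T| * b.-1)%N by nia.
rewrite iterD; congr iter; apply/esym/eqP.
by rewrite iter_cyclic_eq// dvdn_mulr.
Qed.

(** Block 1 starts with [s (x 0)], the second letter of block 0. *)
Lemma square_run j : (1 <= j < b)%N -> x (j + b.-1)%N = x j.
Proof.
move=> Hj.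
have -> : (j + b.-1 = b * 1 + j.-1)%N by lia.
rewrite x_block 1?[RHS]digit_sum_word_small; [|lia..].
have := digit_sum_word_pow 0; rewrite expn0 => ->.
by rewrite -iterSr prednK//; lia.
Qed.

End DigitSumWord.

(** * Rational powers as runs *)

Lemma nth_flatten_nseq (T : Type) (y : T) (w v : seq T) n k :
  nth y (flatten (nseq n w) ++ v) k =
  if (k < n * size w)%N then nth y w (k %% size w) else nth y v (k - n * size w).
Proof.
elim: n k => [|n IHn] k /=; first by rewrite subn0.
rewrite -catA nth_cat mulSn.
have [lt_k|le_k] := ltnP k (size w); first by rewrite ltn_addr// modn_small.
have -> : (k %% size w = (k - size w) %% size w)%N.
  by rewrite -[in LHS](subnK le_k) modnDr.
by rewrite IHn subnDA ltn_subLR.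
Qed.

(** Eliminates both floors: later arguments need only the length [N] and indices modulo [size w]. *)
Lemma rat_power_mkseq (T : choiceType) (y : T) (w : seq T) r N :
  (0 < size w)%N -> 0 < r -> r * (size w)%:R = N%:R ->
  rat_power w r = mkseq (fun k => nth y w (k %% size w)) N.
Proof.
set p := size w => p_gt0 r_gt0 rE.
have p0 : (0 : rat) < p%:R by rewrite ltr0n.
have truncr : Num.truncn r = (N %/ p)%N.
  apply: truncn_def; rewrite -(ler_pM2r p0) -(ltr_pM2r p0) rE -!natrM ler_nat ltr_nat.
  by rewrite leq_trunc_div ltn_ceil.
have def_N := divn_eq N p; have lt_mod := ltn_pmod N p_gt0.
have -> : rat_power w r = flatten (nseq (N %/ p) w) ++ take (N %% p) w.
  rewrite /rat_power truncr mulrBl rE -natrM -natrB ?leq_trunc_div//.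
  by rewrite natrK; congr (_ ++ take _ _); lia.
have size_fl : size (flatten (nseq (N %/ p) w)) = (N %/ p * p)%N.
  by rewrite size_flatten /shape map_nseq sumn_nseq mulnC.
apply: (@eq_from_nth _ y) => [|k].
  by rewrite size_cat size_fl size_takel ?size_mkseq ?(ltnW lt_mod).
rewrite size_cat size_fl size_takel ?(ltnW lt_mod)// -def_N => lt_k.
rewrite nth_mkseq// nth_flatten_nseq -/p.
case: ltnP => // le_k; rewrite nth_take; last by lia.
congr nth; have -> : (k = N %/ p * p + (k - N %/ p * p))%N by lia.
by rewrite modnMDl modn_small ?addKn//; lia.
Qed.

Lemma exponentsP (T : choiceType) (x : nat -> T) (w : seq T) (r : rat) :
  (0 < size w)%N ->
  exponents x w r <->
  0 < r /\ exists i N, r * (size w)%:R = N%:R /\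
     forall k, (k < N)%N -> x (i + k)%N = nth (x 0%N) w (k %% size w).
Proof.
move=> w_gt0; split=> [[r_gt0 /natrP[N rE] [i wE]]|[r_gt0 [i [N [rE wE]]]]].
  split=> //; exists i, N; split=> // k lt_k.
  move: wE; rewrite (rat_power_mkseq (x 0%N) w_gt0 r_gt0 rE) size_mkseq.
  by move=> /(congr1 (nth (x 0%N) ^~ k)); rewrite !nth_mkseq.
split=> //; first by apply/natrP; exists N.
exists i; rewrite (rat_power_mkseq (x 0%N) w_gt0 r_gt0 rE) size_mkseq.
by apply/eq_in_map => k; rewrite mem_iota => /andP[_ /wE].
Qed.

Lemma is_factor_mkseq (T : choiceType) (x : nat -> T) i p :
  is_factor x (mkseq (fun j => x (i + j)%N) p).
Proof. by exists i; rewrite size_mkseq. Qed.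

Lemma exponents_run (T : choiceType) (x : nat -> T) i p N :
  (0 < p)%N -> (0 < N)%N ->
  (forall k, (k + p < N)%N -> x (i + k)%N = x (i + k + p)%N) ->
  exponents x (mkseq (fun j => x (i + j)%N) p) (N%:R / p%:R).
Proof.
move=> p_gt0 N_gt0 run; apply/exponentsP; rewrite size_mkseq//.
split; first by rewrite divr_gt0// ltr0n.
exists i, N; split; first by rewrite divfK// pnatr_eq0 -lt0n.
move=> k lt_k; rewrite nth_mkseq ?ltn_pmod//.
elim/ltn_ind: k lt_k => k IHk lt_k; have [lt_kp|le_pk] := ltnP k p.
  by rewrite modn_small.
have lt_k' : (k - p + p < N)%N by rewrite subnK.
by rewrite -(subnK le_pk) modnDr addnA -(run _ lt_k') IHk//; lia.
Qed.

Lemma run_exponents (T : choiceType) (x : nat -> T) w r :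
  (0 < size w)%N -> exponents x w r ->
  exists i N, r * (size w)%:R = N%:R /\
  forall k, (k + size w < N)%N -> x (i + k)%N = x (i + k + size w)%N.
Proof.
move=> w_gt0 /(exponentsP _ _ w_gt0)[_ [i [N [rE wE]]]]; exists i, N; split=> //.
by move=> k lt_k; rewrite -addnA !wE ?modnDr//; lia.
Qed.

(** * Bounds on the index and the critical exponent *)

Lemma le_Index (R : realType) (T : choiceType) (x : nat -> T) w r :
  exponents x w r -> ((ratr r)%:E <= Index R x w)%E.
Proof.
move=> rA; rewrite /Index; case: xgetP => [_ -> [q [_ qub] <-]|_]; last exact: leey.
by rewrite lee_fin ler_rat; exact: qub.
Qed.

Lemma Index_unbounded (R : realType) (T : choiceType) (x : nat -> T) w :
  (forall r, exponents x w r -> exists2 q, exponents x w q & r < q) ->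
  Index R x w = +oo%E.
Proof.
move=> unb; rewrite /Index; case: xgetP => [_ -> [q [/unb[q' q'A lt_q] qub] _]|//].
by have := qub _ q'A; rewrite leNgt lt_q.
Qed.

(** An upper bound alone does not exclude the default [+oo]: a maximum exists because the exponents
    are multiples of [1 / size w] and 1 is one of them. *)
Lemma Index_le (R : realType) (T : choiceType) (x : nat -> T) w (c : rat) :
  w <> [::] -> is_factor x w -> (forall r, exponents x w r -> r <= c) ->
  (Index R x w <= (ratr c)%:E)%E.
Proof.
move=> w_neq0 [i wE] cub.
have w_gt0 : (0 < size w)%N by case: (w) w_neq0.
have w0 : (0 : rat) < (size w)%:R by rewrite ltr0n.
pose P N := `[< exponents x w (N%:R / (size w)%:R) >].
have P1 : exists N, P N.
  exists (size w); apply/asboolP; rewrite {1}wE.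
  by apply: exponents_run => // k; rewrite -[X in (_ < X)%N]add0n ltn_add2r.
have Pub N : P N -> (N <= Num.truncn (c * (size w)%:R))%N.
  move=> /asboolP/cub; rewrite ler_pdivrMr// => leN.
  by rewrite truncn_ge_nat// (le_trans _ leN).
case: (ex_maxnP P1 Pub) => N /asboolP NA Nmax.
rewrite /Index; case: xgetP => [_ -> [q [qA _] <-]|noMax].
  by rewrite lee_fin ler_rat; exact: cub.
exfalso; apply: (noMax (ratr (N%:R / (size w)%:R))%:E).
exists (N%:R / (size w)%:R) => //; split=> // r rA.
have [_ /natrP[M rE] _] := rA.
have def_r : r = M%:R / (size w)%:R by rewrite -rE mulfK// gt_eqF.
by rewrite def_r ler_pM2r ?invr_gt0// ler_nat; apply: Nmax; apply/asboolP; rewrite -def_r.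
Qed.

Lemma critical_exponent_eq (R : realType) (T : choiceType) (x : nat -> T)
    (c : rat) i p N : (0 < p)%N -> (0 < N)%N -> c = N%:R / p%:R ->
  (forall k, (k + p < N)%N -> x (i + k)%N = x (i + k + p)%N) ->
  (forall w r, (0 < size w)%N -> exponents x w r -> r <= c) ->
  critical_exponent R x = (ratr c)%:E.
Proof.
move=> p_gt0 N_gt0 def_c run ub; apply/eqP; rewrite eq_le; apply/andP; split.
  apply: ge_ereal_sup => _ [w [w_neq0 w_fac] <-].
  by apply: Index_le => // r; apply: ub; case: (w) w_neq0.
apply: le_trans (ereal_sup_ubound _); last first.
  exists (mkseq (fun j => x (i + j)%N) p) => //; split; last exact: is_factor_mkseq.
  by case: (p) p_gt0.
by apply: le_Index; rewrite def_c; apply: exponents_run.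
Qed.

Lemma critical_exponent_periodic (R : realType) (T : choiceType) (x : nat -> T) p :
  (0 < p)%N -> (forall k, x k = x (k + p)%N) ->
  critical_exponent R x = +oo%E.
Proof.
move=> p_gt0 per; apply/eqP; rewrite -leye_eq.
pose w := mkseq (fun j => x (0 + j)%N) p.
rewrite -(@Index_unbounded R _ x w); last first.
  (* Periodicity lets every power be extended by one letter. *)
  move=> r [r_gt0 /natrP[N rE] _]; exists (N.+1%:R / p%:R).
    by apply: exponents_run.
  by rewrite ltr_pdivlMr ?ltr0n// -[p in r * p%:R](size_mkseq (fun j => x (0 + j)%N)) rE ltr_nat.
apply: ereal_sup_ubound; exists w => //; split; last exact: is_factor_mkseq.
by rewrite /w; case: (p) p_gt0.
Qed.

Theorem theorem4p4 (R : realType) (b m : nat) (Sigma : finType)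
    (sigma : {perm Sigma}) (abar : Sigma)
    (hb : (2 <= b)%N) (hm : (1 <= m)%N) (hSigma : #|Sigma| = m)
    (hsigma : cyclic_permutation sigma) :
  let t := gen_thue_morse b sigma abar in
  [/\ (m %| b - 1)%N -> critical_exponent R t = +oo%E,
      ~~ (m %| b - 1)%N -> (m < b)%N ->
        critical_exponent R t = (2 * b%:R / m%:R)%:E
    & (b <= m)%N -> critical_exponent R t = 2%:E].
Proof.
move=> t; subst m.
have tE : digit_sum_word b sigma t by move=> q r; exact: gen_thue_morse_block.
have iterT y : iter #|Sigma| sigma y = y by apply/eqP; rewrite iter_cyclic_eq.
have T0 : (0 : rat) < #|Sigma|%:R by rewrite ltr0n.
have ub w r : ~~ (#|Sigma| %| b - 1)%N -> (0 < size w)%N -> exponents t w r ->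
    r <= 2 \/ r <= (2 * b)%:R / #|Sigma|%:R.
  move=> mNb w_gt0 /(run_exponents w_gt0)[i [N [rE run]]].
  have w0 : (0 : rat) < (size w)%:R by rewrite ltr0n.
  (* Truncated subtraction leaves no comparison when the power is shorter than [w]. *)
  have run' j : (i <= j < i + (N - size w))%N -> t j = t (j + size w)%N.
    by move=> Hj; rewrite -(subnKC (_ : i <= j)%N) ?run//; lia.
  have [le_N|le_N] := short_run hb hsigma tE mNb w_gt0 run'; [left|right].
    by rewrite -(ler_pM2r w0) rE -natrM ler_nat; lia.
  rewrite ler_pdivlMr// -(ler_pM2r w0) mulrAC rE -!natrM ler_nat.
  by apply: leq_trans le_N; rewrite mulnC leq_mul2l; lia.
split=> [mb|mNb lt_mb|le_bm].
- apply: (critical_exponent_periodic R hm) => k.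
  by rewrite [LHS](digit_sum_word_periodic hb hsigma tE)//
      [RHS](digit_sum_word_periodic hb hsigma tE)// iterD iterT.
(* For [#|Sigma| < b] the second bound of [ub] dominates the first. *)
- have le2 : (2 : rat) <= (2 * b)%:R / #|Sigma|%:R.
    by rewrite ler_pdivlMr// -natrM ler_nat leq_mul2l (ltnW lt_mb).
  rewrite (@critical_exponent_eq R _ t ((2 * b)%:R / #|Sigma|%:R)
    (b * (b ^ #|Sigma|.-1).-1) #|Sigma| (2 * b)) ?muln_gt0 ?(ltnW hb)//.
  + by rewrite fmorph_div !rmorph_nat natrM.
  + move=> k lt_k; rewrite -addnA !(long_run hb hsigma tE) ?iterD ?iterT//.
    by apply: leq_ltn_trans lt_k; rewrite leq_addr.
  + by move=> w r w_gt0 /(ub w r mNb w_gt0)[/le_trans->|].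
(* Here [0 < b - 1 < #|Sigma|]. *)
have mNb : ~~ (#|Sigma| %| b - 1)%N by apply/negP => /dvdn_leq; lia.
rewrite (@critical_exponent_eq R _ t 2 1 b.-1 (2 * b.-1)).
- by rewrite rmorph_nat.
- by lia.
- by lia.
- by rewrite natrM mulfK// pnatr_eq0; lia.
- move=> k lt_k; rewrite (square_run hb tE)//; lia.
- move=> w r w_gt0 /(ub w r mNb w_gt0)[//|/le_trans]; apply.
  by rewrite ler_pdivrMr// -natrM ler_nat leq_mul2l le_bm.
Qed.
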